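(* There is a deterministic distributed algorithm in the CONGEST model that computes a maximal independent set of the input graph $G$ within $O(D\log^2 n)$ rounds, where $n$ is the number of nodes and $D$ is the diameter of $G$.
   Context: The input is a connected undirected graph $G=(V,E)$ with $n=|V|$ nodes, each node knowing its own unique $O(\log n)$-bit identifier and its incident edges. In the CONGEST model the communication network is $G$ itself: computation proceeds in synchronous rounds, in each round each node may send a (possibly different) message of $O(\log n)$ bits to each of its neighbors in $G$, and local computation is free. A maximal independent set is a set $I\subseteq V$ with no two nodes of $I$ adjacent such that every node outside $I$ has a neighbor in $I$; at the end every node must know whether it belongs to $I$. *)

(* Defs.v *)
From mathcomp Require Import all_boot.
Set Implicit Arguments. Unset Strict Implicit. Unset Printing Implicit Defensive.

Fixpoint ball (V : finType) (adj : rel V) (k : nat) (u : V) : {set V} :=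
  match k with
  | 0 => [set u]
  | k'.+1 => ball adj k' u :|: [set y | [exists x in ball adj k' u, adj x y]]
  end.

Definition connected (V : finType) (adj : rel V) : Prop :=
  forall u v : V, connect adj u v.

Definition is_diameter (V : finType) (adj : rel V) (D : nat) : Prop :=
  (forall u v : V, v \in ball adj D u) /\
  (forall D' : nat, (forall u v : V, v \in ball adj D' u) -> D <= D').

Definition independent (V : finType) (adj : rel V) (I : {set V}) : Prop :=
  forall u v : V, u \in I -> v \in I -> ~~ adj u v.

Definition is_MIS (V : finType) (adj : rel V) (I : {set V}) : Prop :=
  independent adj I /\
  (forall v : V, v \notin I -> exists u : V, (u \in I) && adj v u).

(* A (uniform) deterministic distributed algorithm.  Local computation is
   unrestricted: the local state space is an arbitrary type.
   - init id nbrs : initial state of a node with identifier id whose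
     neighbours have identifiers nbrs (sorted increasingly);
   - send s j     : message (a bit string) sent in the current round to the
     neighbour with identifier j, or None for no message;
   - step s r     : new state, where r j is the message received from the
     neighbour with identifier j (None if none / not a neighbour);
   - out s        : Some b once the node has irrevocably decided b
     (b = true means "in the independent set"), None while undecided. *)
Unset Implicit Arguments.
Record algorithm := Algorithm {
  state : Type;
  init : nat -> seq nat -> state;
  send : state -> nat -> option (seq bool);
  step : state -> (nat -> option (seq bool)) -> state;
  out : state -> option bool
}.
Set Implicit Arguments.

Definition nbr_ids (V : finType) (adj : rel V) (id : V -> nat) (v : V) : seq nat :=
  sort leq [seq id u | u <- enum V & adj v u].

Fixpoint run (A : algorithm) (V : finType) (adj : rel V) (id : V -> nat)
    (t : nat) : V -> state A :=
  match t with
  | 0 => fun v => init A (id v) (nbr_ids adj id v)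
  | t'.+1 => fun v =>
      let prev := run A adj id t' in
      step A (prev v)
        (fun j => if [pick u | adj v u && (id u == j)] is Some u
                  then send A (prev u) (id v) else None)
  end.

(* Main.v *)
Require Import Defs.
From mathcomp Require Import all_boot.
From mathcomp Require Import zify ssralg finalg finfield ring.
From Stdlib Require Import FunctionalExtensionality.
Set Implicit Arguments. Unset Strict Implicit. Unset Printing Implicit Defensive.

(* Luby's algorithm, derandomised by conditional expectations along a BFS tree.

   In one phase an active node of degree d > 0 is marked with probability about
   1/(4d), and joins if no neighbour of at least its degree is marked.  The
   analysis only uses pairs of marks, so marks may come from h(x) = a x + b over
   GF(2^k), where 2^k exceeds all identifiers: the seed (a, b) has O(log n) bits.
   For a node v of degree d_v, choose a set S_v of neighbours of degree at most
   d_v.  By inclusion-exclusion,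
     [v gets a neighbour in I]  >=  sum_{u in S_v} [u joins] - t (t - 1),
   where t is the number of marked nodes in S_v.  If S_v is as large as possible
   with expectation E[t] <= 1/2, then the sum over v of d_v times the right-hand
   side has expectation at least 1/64 of the sum of all degrees.  The terms are
   known to the nodes, so the seed can be fixed bit by bit, each bit costing two
   global sums, i.e. O(D) rounds.  Since degrees of dominated nodes vanish,
   O(log n) phases remove all edges.

   Neither n nor D is known.  Attempt i uses the guess 2^i for the depth of the
   tree rooted at the node of maximum identifier; that node detects whether its
   ball of radius 2^i is the whole graph, and otherwise all nodes move on to
   attempt i + 1 at the same time. *)

(** * Lock-step programs and their network execution *)

Fixpoint bits (k m : nat) : seq bool :=
  if k is k'.+1 then odd m :: bits k' m./2 else [::].

Definition encode (m : nat) : seq bool := bits (trunc_log 2 m).+1 m.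

Definition decode (s : seq bool) : nat := foldr (fun (b : bool) x => b + x.*2) 0 s.

Lemma size_bits k m : size (bits k m) = k.
Proof. by elim: k m => //= k IH m; rewrite IH. Qed.

Lemma bitsK k m : m < 2 ^ k -> decode (bits k m) = m.
Proof.
elim: k m => [|k IH] m; first by case: m.
rewrite expnS mul2n => lt_m /=; rewrite IH ?odd_double_half //.
by rewrite -ltn_double (leq_ltn_trans _ lt_m) // -{2}(odd_double_half m) leq_addl.
Qed.

Lemma encodeK : cancel encode decode.
Proof. by move=> m; rewrite bitsK // trunc_log_ltn. Qed.

Lemma size_encode m x : m <= 2 ^ x -> size (encode m) <= x.+1.
Proof.
by move=> le_m; rewrite size_bits ltnS -[leqRHS](@trunc_expnK 2 x) // leq_trunc_log.
Qed.

(** One [Comm] is one synchronous round: [m j] goes to neighbour [j], and [k] consumes the incoming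
    numbers. *)
Inductive prog (A : Type) : Type :=
| Ret (a : A)
| Comm (m : nat -> nat) (k : (nat -> nat) -> prog A).
Arguments Comm {A} m k.

Fixpoint bind A B (p : prog A) (f : A -> prog B) : prog B :=
  match p with
  | Ret a => f a
  | Comm m k => Comm m (fun r => bind (k r) f)
  end.

Fixpoint flood (nbrs : seq nat) (k x : nat) : prog nat :=
  if k is k'.+1
  then Comm (fun=> x) (fun r => flood nbrs k' (maxn x (\max_(j <- nbrs) r j)))
  else Ret x.

(* [None] means not yet reached; the root carries a dummy parent. *)
Fixpoint bfs (nbrs : seq nat) (k : nat) (par : option nat) : prog (option nat) :=
  if k is k'.+1
  then Comm (fun=> nat_of_bool (par != None))
         (fun r => bfs nbrs k'
            (if par is None
             then ohead [seq j <- nbrs | r j == 1] else par))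
  else Ret par.

(* Every node but the root hands its whole accumulated sum over to its parent in
   every round, so that after [k] rounds a tree of depth [k] has emptied into
   its root. *)
Fixpoint collect (nbrs : seq nat) (root : bool) (par : nat) (k x : nat)
    : prog nat :=
  if k is k'.+1
  then Comm (fun j => if ~~ root && (j == par) then x else 0)
         (fun r => collect nbrs root par k'
                     ((if root then x else 0) + \sum_(j <- nbrs) r j))
  else Ret x.

Definition tree_sum (nbrs : seq nat) (root : bool) (par k x : nat) : prog nat :=
  bind (collect nbrs root par k x)
       (fun y => flood nbrs k (if root then y else 0)).

(* Conditional expectations: one bit of the seed is fixed per iteration, keeping
   the half of the seed interval on which the sum of [P - Q] is larger. *)
Fixpoint derand (tot : nat -> prog nat) (L a : nat) (P Q : nat -> nat)
    : prog nat :=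
  if L is L'.+1 then
    bind (tot (\sum_(a <= s < a + 2 ^ L') P s
               + \sum_(a + 2 ^ L' <= s < a + 2 ^ L) Q s)) (fun x0 =>
    bind (tot (\sum_(a <= s < a + 2 ^ L') Q s
               + \sum_(a + 2 ^ L' <= s < a + 2 ^ L) P s)) (fun x1 =>
    derand tot L' (if x1 <= x0 then a else a + 2 ^ L') P Q))
  else Ret a.

(** * Lock-step execution on a graph *)

Section Network.

Variables (V : finType) (adj : rel V) (id : V -> nat).
Hypothesis (adj_sym : symmetric adj) (id_inj : injective id).

Local Notation nb := (nbr_ids adj id).

Definition recv (m : V -> nat -> nat) (v : V) : nat -> nat := fun j =>
  if [pick u | adj v u && (id u == j)] is Some u then m u (id v) else 0.

(* [exec b T P a]: started from the programs [P], all nodes simultaneously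
   return [a] after exactly [T] rounds, and no message exceeds [b]. *)
Inductive exec (b : nat) (A : Type) : nat -> (V -> prog A) -> (V -> A) -> Prop :=
| exec_ret P a : (forall v, P v = Ret (a v)) -> exec b 0 P a
| exec_comm P m k T a :
    (forall v, P v = Comm (m v) (k v)) ->
    (forall v u, adj v u -> m v (id u) <= b) ->
    exec b T (fun v => k v (recv m v)) a -> exec b T.+1 P a.

Lemma recvE m v u : adj v u -> recv m v (id u) = m u (id v).
Proof.
rewrite /recv => vu; case: pickP => [w /andP[_ /eqP/id_inj ->] //|/(_ u)].
by rewrite vu eqxx.
Qed.

Lemma perm_nbr v : perm_eq (nb v) [seq id u | u <- enum (adj v)].
Proof.
rewrite /nbr_ids perm_sort; apply/perm_map/uniq_perm;
  rewrite ?filter_uniq -?enumT ?enum_uniq //.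
by move=> u; rewrite mem_filter !mem_enum andbT.
Qed.

Lemma mem_nbr v j : reflect (exists2 u, adj v u & j = id u) (j \in nb v).
Proof.
rewrite (perm_mem (perm_nbr v)); apply: (iffP mapP) => -[u].
  by rewrite mem_enum => vu ->; exists u.
by move=> vu ->; exists u; rewrite // mem_enum.
Qed.

Lemma id_nbr v u : (id u \in nb v) = adj v u.
Proof.
by apply/mem_nbr/idP => [[w vw /id_inj ->] //|vu]; exists u.
Qed.

Lemma big_nbr (R : Type) (idx : R) (op : Monoid.com_law idx) v (P : pred nat)
    (F : nat -> R) :
  \big[op/idx]_(j <- nb v | P j) F j =
  \big[op/idx]_(u | adj v u && P (id u)) F (id u).
Proof. by rewrite (perm_big _ (perm_nbr v)) big_map big_enum_cond. Qed.

Lemma big_recv (idx : nat) (op : Monoid.com_law idx) v m :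
  \big[op/idx]_(j <- nb v) recv m v j =
  \big[op/idx]_(u | adj v u) m u (id v).
Proof.
rewrite big_nbr; apply: eq_big => [u|u /andP[vu _]]; first by rewrite andbT.
exact: recvE.
Qed.

(** Times add because [exec] makes all nodes leave the first program in the same round. *)
Lemma exec_bind b A B T1 T2 (P : V -> prog A) a (f : V -> A -> prog B) c :
  exec b T1 P a -> exec b T2 (fun v => f v (a v)) c ->
  exec b (T1 + T2) (fun v => bind (P v) (f v)) c.
Proof.
move=> exP; elim: exP f => {T1 P a} [P a Pa|P m k T a Pm mb exP IH] f exf.
  have -> : (fun v => bind (P v) (f v)) = (fun v => f v (a v)) => //.
  by apply: functional_extensionality => v; rewrite Pa.
apply: (exec_comm (k := fun v r => bind (k v r) (f v)) _ mb (IH _ exf)) => v.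
by rewrite Pm.
Qed.

Lemma exec_eq b A T (P P' : V -> prog A) a :
  P =1 P' -> exec b T P a -> exec b T P' a.
Proof. by move/functional_extensionality->. Qed.

Lemma exec_round b A T (m : V -> nat -> nat) k (a : V -> A) :
  (forall v u, adj v u -> m v (id u) <= b) ->
  exec b T (fun v => k v (recv m v)) a ->
  exec b T.+1 (fun v => Comm (m v) (k v)) a.
Proof. exact: exec_comm. Qed.

Lemma ball_refl k v : v \in ball adj k v.
Proof. by elim: k => [|k IH] /=; rewrite ?in_set1 // inE IH. Qed.

Lemma ball_leq k l v : k <= l -> ball adj k v \subset ball adj l v.
Proof.
move=> /subnK <-; elim: (l - k) => // n IH.
by rewrite addSn /=; apply: subset_trans IH (subsetUl _ _).
Qed.

Lemma ballS k v w :
  reflect (exists2 u, u \in ball adj k v & (w == u) || adj u w)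
          (w \in ball adj k.+1 v).
Proof.
rewrite /= !inE; apply: (iffP orP) => [[wv|/existsP[u /andP[uv uw]]]|[u uv]].
- by exists w; rewrite // eqxx.
- by exists u; rewrite // uw orbT.
case/orP=> [/eqP ->|uw]; first by left.
by right; apply/existsP; exists u; rewrite uv.
Qed.

(** Balls grow at the far end; [front] shows that an edge can also be prepended at the cost of one
    unit of radius, so walks can be reversed. *)
Lemma ball_sym k v w : (w \in ball adj k v) = (v \in ball adj k w).
Proof.
suff imp x y : y \in ball adj k x -> x \in ball adj k y by apply/idP/idP; apply: imp.
have front l : forall u z t, adj u z -> t \in ball adj l z -> t \in ball adj l.+1 u.
  elim: l => [|l IH] u z t uz.
    by rewrite in_set1 => /eqP->; apply/ballS; exists u; rewrite ?ball_refl ?uz ?orbT.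
  by case/ballS=> s sz st; apply/ballS; exists s; rewrite ?(IH _ z).
elim: k x y => [|k IH] x y; first by rewrite !in_set1 eq_sym.
case/ballS=> u /IH xu /orP[/eqP->|uy].
  exact: subsetP (ball_leq _ (leqnSn k)) _ xu.
by apply: front xu; rewrite adj_sym.
Qed.

Lemma exec_flood b k (f : V -> nat) :
  (forall v, f v <= b) ->
  exec b k (fun v => flood (nb v) k (f v)) (fun v => \max_(u in ball adj k v) f u).
Proof.
elim: k f => [|k IH] f fb; first by apply: exec_ret => v /=; rewrite big_set1.
(* The first round replaces [f] by its maximum [g] over closed neighbourhoods, and the [k]-ball
   maximum of [g] is the [k.+1]-ball maximum of [f]. *)
pose g v := maxn (f v) (\max_(u | adj v u) f u).
have gb v : g v <= b by rewrite geq_max fb; apply/bigmax_leqP.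
have -> : (fun v => \max_(u in ball adj k.+1 v) f u) =
          (fun v => \max_(u in ball adj k v) g u).
  apply: functional_extensionality => v; apply/eqP; rewrite eqn_leq; apply/andP; split.
    apply/bigmax_leqP => w /ballS[u uv wu]; apply: (@leq_trans (g u));
      last exact: leq_bigmax_cond.
    rewrite /g; case/orP: wu => [/eqP->|uw]; first exact: leq_maxl.
    by rewrite leq_max (leq_bigmax_cond w (F := f)) ?orbT.
  apply/bigmax_leqP => u uv; rewrite geq_max leq_bigmax_cond; last first.
    exact: subsetP (ball_leq _ (leqnSn k)) _ uv.
  apply/bigmax_leqP => w uw; apply: leq_bigmax_cond.
  by apply/ballS; exists u; rewrite ?uw ?orbT.
apply: exec_round => // {fb}.
apply: exec_eq (IH g gb) => v; congr flood.
by rewrite (big_recv maxn).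
Qed.

(** * Broadcast, summation and seed search along a BFS tree *)

Section Tree.

Variables (root : V) (depth : nat).
Hypothesis root_ball : forall v, v \in ball adj depth root.

Lemma exec_bcast b x :
  x <= b ->
  exec b depth (fun v => flood (nb v) depth (if v == root then x else 0))
       (fun=> x).
Proof.
move=> xb; have -> : (fun=> x) =
   (fun v => \max_(u in ball adj depth v) (if u == root then x else 0)).
  apply: functional_extensionality => v; apply/eqP; rewrite eqn_leq; apply/andP; split.
    apply: leq_trans (leq_bigmax_cond root _); first by rewrite eqxx.
    by rewrite ball_sym.
  by apply/bigmax_leqP => u _; case: ifP.
by apply: exec_flood => v; case: ifP.
Qed.

Definition tree_parent (par : V -> option nat) (t : nat) (lev : V -> nat) :=
  lev root = 0 /\
  forall v, v \in ball adj t root -> v != root ->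
    exists u, [/\ adj v u, par v = Some (id u), u \in ball adj t root,
                 lev u < lev v & lev v <= t].

Lemma exec_bfs b :
  0 < b ->
  exists par lev,
    exec b depth (fun v => bfs (nb v) depth (if v == root then Some 0 else None))
         par
    /\ tree_parent par depth lev.
Proof.
move=> b_gt0.
(* Invariant after [t] rounds: exactly the nodes of the [t]-ball are reached, and they form a tree
   of depth at most [t]. *)
suff gen k t par lev : t + k = depth ->
    (forall v, (par v != None) = (v \in ball adj t root)) ->
    (forall v, lev v <= t) -> tree_parent par t lev ->
    exists par' lev', exec b k (fun v => bfs (nb v) k (par v)) par'
                   /\ tree_parent par' (t + k) lev'.
  apply: (gen depth 0 _ (fun=> 0)) => // [v|]; first by rewrite in_set1; case: (v == root).
  by split=> // v; rewrite in_set1 => ->.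
elim: k t par lev => [|k IH] t par lev tk parP levt [lev0 treeP].
  exists par, lev; split; last by rewrite addn0.
  exact: exec_ret.
pose m v (j : nat) : nat := par v != None.
pose par' v := if par v is None then ohead [seq j <- nb v | recv m v j == 1]
               else par v.
pose lev' v := if par v is None then t.+1 else lev v.
have newP v : par v = None -> v \in ball adj t.+1 root ->
    exists u, [/\ adj v u, par' v = Some (id u) & par u <> None].
  move=> pv vt; rewrite /par' pv.
  have: has (fun j => recv m v j == 1) (nb v).
    case/ballS: vt => u; rewrite -parP => pu /orP[/eqP vu|uv].
      by rewrite -vu pv in pu.
    by apply/hasP; exists (id u); rewrite ?id_nbr ?recvE 1?adj_sym // /m pu.
  rewrite has_filter; case E: [seq _ <- _ | _] => [//|j s] _ /=.
  have: j \in [seq j <- nb v | recv m v j == 1] by rewrite E mem_head.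
  rewrite mem_filter => /andP[jm /mem_nbr[u vu ju]]; exists u; split=> //.
    by rewrite ju.
  by move: jm; rewrite ju recvE // /m; case: (par u).
have [|v|v||p [l [exl tl]]] := IH t.+1 par' lev'.
- by rewrite addSnnS.
- apply/idP/idP => [pv|vt]; last first.
    case pv: (par v) => [x|]; first by rewrite /par' pv.
    by have [u [_ -> _]] := newP v pv vt.
  case E: (par v) => [x|].
    by apply: (subsetP (ball_leq _ (leqnSn t))); rewrite -parP E.
  move: pv; rewrite /par' E; case F: [seq _ <- _ | _] => [//|j s] _.
  have: j \in [seq j <- nb v | recv m v j == 1] by rewrite F mem_head.
  rewrite mem_filter => /andP[jm /mem_nbr[u vu ju]].
  apply/ballS; exists u; last by rewrite adj_sym vu orbT.
  by move: jm; rewrite ju recvE // /m -parP; case: (par u).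
- by rewrite /lev'; case: (par v) => // x; apply: leqW.
- split=> [|v vt nvr].
    rewrite /lev'; case E: (par root) => //.
    by have := parP root; rewrite ball_refl E.
  case E: (par v) => [x|].
    have vt' : v \in ball adj t root by rewrite -parP E.
    have [u [vu pu ut lu lv]] := treeP v vt' nvr.
    exists u; rewrite /par' /lev' E; split=> //; first by rewrite -E.
    + exact: subsetP (ball_leq _ (leqnSn t)) _ ut.
    + by move: ut; rewrite -parP; case: (par u).
    exact: leqW.
  have [u [vu pu nu]] := newP v E vt.
  exists u; rewrite /lev' E; split=> //.
    by apply: (subsetP (ball_leq _ (leqnSn t))); rewrite -parP; case: (par u) nu.
  by case: (par u) nu => // x _; rewrite ltnS.
exists p, l; rewrite addnS -addSn; split=> //.
apply: exec_round => // v u _.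
exact: leq_trans (leq_b1 _) b_gt0.
Qed.

Variables (par : V -> option nat) (lev : V -> nat).
Hypothesis treeP : tree_parent par depth lev.

Local Notation parent v := (odflt 0 (par v)).

Lemma exec_collect b (x : V -> nat) :
  \sum_v x v <= b ->
  exists a, exec b depth
      (fun v => collect (nb v) (v == root) (parent v) depth (x v)) a
    /\ a root = \sum_v x v.
Proof.
have [lev0 parP] := treeP.
have parE v : v != root ->
    exists u, [/\ adj v u, parent v = id u, lev u < lev v & lev v <= depth].
  by move=> /(parP v (root_ball v))[u [vu -> _ uv vd]]; exists u.
(* Invariant: with [k] rounds left, nonzero values sit at levels at most [k]. A round moves each of
   them to a parent, hence to a smaller level, and preserves the total, which also bounds the
   messages. *)
have: forall v, x v != 0 -> lev v <= depth.
  move=> v _; have [->|/parE[u []]//] := eqVneq v root.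
  by rewrite lev0.
move: {1 2 3}depth => k; elim: k x => [|k IH] x xk xb.
  exists x; split; first exact: exec_ret.
  rewrite (bigD1 root) //= big1 ?addn0 // => v nvr.
  apply: contraTeq isT => /xk; rewrite leqn0 => /eqP lv.
  by have [u []] := parE v nvr; rewrite lv.
pose m v j := if (v != root) && (j == parent v) then x v else 0.
pose x' v := (if v == root then x v else 0) + \sum_(u | adj v u) m u (id v).
have x'sum : \sum_v x' v = \sum_v x v.
  rewrite big_split /= (exchange_big_dep xpredT) //= -big_split /=.
  apply: eq_bigr => v _; rewrite /m; case: eqVneq => [->|nvr] /=.
    by rewrite big1 ?addn0.
  rewrite add0n; have [u [vu -> _ _]] := parE v nvr.
  rewrite (bigD1 u) /=; last by rewrite adj_sym.
  rewrite eqxx big1 ?addn0 // => w /andP[_]; rewrite (inj_eq id_inj).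
  by move/negPf->.
have [v||a [exa aroot]] := IH x'; last first.
- exists a; split; last by rewrite aroot.
  apply: exec_round => [v u vu|]; last first.
    apply: exec_eq exa => v; congr collect; congr (_ + _).
    by rewrite (big_recv addn).
  case: ifP => // _; apply: leq_trans xb.
  by rewrite (bigD1 v) //= leq_addr.
- by rewrite x'sum.
rewrite /x'; case: (eqVneq v root) => [->|nvr]; first by rewrite lev0.
rewrite add0n sum_nat_eq0 => /forall_inPn[u vu].
rewrite /m; case: ifP => // /andP[nur /eqP idv] /xk lu.
have [w [uw pw lw _]] := parE u nur.
by move: idv lw; rewrite pw => /id_inj <- /leq_trans/(_ lu).
Qed.

Lemma exec_tree_sum b (x : V -> nat) :
  \sum_v x v <= b ->
  exec b (depth + depth)
    (fun v => tree_sum (nb v) (v == root) (parent v) depth (x v))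
    (fun=> \sum_v x v).
Proof.
move=> xb; have [a [exa aroot]] := exec_collect xb.
apply: exec_bind exa _; apply: exec_eq (exec_bcast xb) => v.
by case: eqP => // ->; rewrite aroot.
Qed.

(** The inequality says that the average of [P - Q] over the seed interval is at most its value at
    [s], cleared of subtraction and division. It survives each bit because the better half has at
    least the average of the whole. *)
Lemma exec_derand b bP bQ L a (P Q : V -> nat -> nat) :
  (forall s, \sum_v P v s <= bP) -> (forall s, \sum_v Q v s <= bQ) ->
  2 ^ L * (bP + bQ) <= b ->
  exists s,
    exec b (L * (4 * depth))
      (fun v => derand (tree_sum (nb v) (v == root) (parent v) depth) L a
                       (P v) (Q v)) (fun=> s)
    /\ \sum_(a <= s' < a + 2 ^ L) \sum_v P v s' + 2 ^ L * \sum_v Q v s <=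
       2 ^ L * \sum_v P v s + \sum_(a <= s' < a + 2 ^ L) \sum_v Q v s'.
Proof.
move=> leP leQ; elim: L a => [|L IH] a leb.
  exists a; split; first exact: exec_ret.
  by rewrite !mul1n addn1 !big_nat1 addnC.
have leb' : 2 ^ L * (bP + bQ) <= b.
  by apply: leq_trans leb; rewrite leq_mul2r leq_pexp2l ?orbT.
(* Cross sums avoid negative numbers: [x0 - x1] is the total of [P - Q] over the left half minus
   that over the right half. *)
pose x0 := \sum_v (\sum_(a <= s < a + 2 ^ L) P v s
               + \sum_(a + 2 ^ L <= s < a + 2 ^ L.+1) Q v s).
pose x1 := \sum_v (\sum_(a <= s < a + 2 ^ L) Q v s
               + \sum_(a + 2 ^ L <= s < a + 2 ^ L.+1) P v s).
have sum_le (F : V -> nat -> nat) bF c : (forall s, \sum_v F v s <= bF) ->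
    \sum_(c <= s < c + 2 ^ L) \sum_v F v s <= 2 ^ L * bF.
  move=> leF; apply: leq_trans (leq_sum _ (fun s _ => leF s)) _.
  by rewrite sum_nat_const_nat addKn.
have aL : a + 2 ^ L.+1 = a + 2 ^ L + 2 ^ L by rewrite expnS mul2n -addnn addnA.
have x0E : x0 = \sum_(a <= s < a + 2 ^ L) \sum_v P v s
             + \sum_(a + 2 ^ L <= s < a + 2 ^ L.+1) \sum_v Q v s.
  by rewrite /x0 big_split /= exchange_big /=; congr (_ + _); rewrite exchange_big.
have x1E : x1 = \sum_(a <= s < a + 2 ^ L) \sum_v Q v s
             + \sum_(a + 2 ^ L <= s < a + 2 ^ L.+1) \sum_v P v s.
  by rewrite /x1 big_split /= exchange_big /=; congr (_ + _); rewrite exchange_big.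
have x0b : x0 <= b.
  by apply: leq_trans leb'; rewrite x0E aL mulnDr leq_add ?sum_le.
have x1b : x1 <= b.
  by apply: leq_trans leb'; rewrite x1E aL mulnDr addnC leq_add ?sum_le.
have [s [exs les]] := IH (if x1 <= x0 then a else a + 2 ^ L) leb'.
exists s; split.
  have -> : L.+1 * (4 * depth) = depth + depth + (depth + depth + L * (4 * depth)).
    by rewrite mulSn addnA; congr (_ + _); rewrite !mulSn addn0 !addnA.
  by apply: exec_bind (exec_tree_sum x0b) _; apply: exec_bind (exec_tree_sum x1b) _.
have cat F : \sum_(a <= s < a + 2 ^ L.+1) F s =
    \sum_(a <= s < a + 2 ^ L) F s + \sum_(a + 2 ^ L <= s < a + 2 ^ L.+1) F s.
  by rewrite (@big_cat_nat _ _ _ (a + 2 ^ L)) ?leq_addr //= aL leq_addr.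
rewrite !cat; move: les; rewrite aL in x0E x1E *; rewrite expnS.
by move: x0E x1E; case: (leqP x1 x0) => le01; lia.
Qed.
End Tree.
End Network.

(** * A pairwise independent hash family *)

Section Hash.

Variable k : nat.

Definition hash_field : finFieldType :=
  s2val (@pPrimePowerField 2 k.+1 isT (ltn0Sn k)).

Lemma card_hash_field : #|hash_field| = 2 ^ k.+1.
Proof. exact: s2valP' (@pPrimePowerField 2 k.+1 isT (ltn0Sn k)). Qed.

Local Notation F := hash_field.

(** Seeds, arguments and values are coded by their rank in an enumeration; an out-of-range seed or
    argument is read as zero. *)
Definition hash (s x : nat) : nat :=
  let ab := nth (0, 0)%R (enum {: F * F}) s in
  index (ab.1 * nth 0 (enum F) x + ab.2)%R (enum F).

Lemma hash_lt s x : hash s x < 2 ^ k.+1.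
Proof. by rewrite -card_hash_field cardE index_mem mem_enum. Qed.

Lemma sum_rank_lt a :
  a <= 2 ^ k.+1 -> \sum_(z : F) (index z (enum F) < a) = a.
Proof.
rewrite -card_hash_field cardE => le_a.
rewrite -big_enum /= (big_nth 0%R) big_mkord.
transitivity (\sum_(i < size (enum F)) (i < a)).
  by apply: eq_bigr => i _; rewrite index_uniq ?enum_uniq.
rewrite -(big_mkord xpredT (fun i => nat_of_bool (i < a))).
rewrite (@big_cat_nat _ _ _ a) //= (eq_big_nat _ _ (F2 := fun=> 1)); last first.
  by move=> i /andP[_ ->].
rewrite sum_nat_const_nat subn0 muln1 big_nat big1 ?addn0 // => i /andP[+ _].
by rewrite leqNgt => /negPf->.
Qed.

(** For distinct points the map [g] from the coefficients to the two values is injective, hence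
    bijective on pairs, so the two values are jointly uniform. *)
Lemma hash_pair x y a b :
  x < 2 ^ k.+1 -> y < 2 ^ k.+1 -> x != y -> a <= 2 ^ k.+1 -> b <= 2 ^ k.+1 ->
  \sum_(0 <= s < 2 ^ (k.+1 + k.+1)) (hash s x < a) * (hash s y < b) = a * b.
Proof.
move=> ltx lty nxy lea leb.
rewrite expnD -card_hash_field -card_prod cardE.
pose ex := nth 0%R (enum F) x; pose ey := nth 0%R (enum F) y.
have nexy : (ex - ey != 0)%R.
  by rewrite GRing.subr_eq0 /ex /ey nth_uniq ?enum_uniq // -cardE card_hash_field.
pose rk (z : F) := index z (enum F).
rewrite -(big_nth (0, 0)%R xpredT (fun ab : F * F =>
  (rk (ab.1 * ex + ab.2)%R < a) * (rk (ab.1 * ey + ab.2)%R < b))) big_enum /=.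
pose g (ab : F * F) := (ab.1 * ex + ab.2, ab.1 * ey + ab.2)%R.
have g_inj : injective g.
  move=> [u1 u2] [w1 w2] [/= e1 e2].
  have e3 : ((u1 - w1) * (ex - ey) = 0)%R.
    transitivity (((u1 * ex + u2) - (u1 * ey + u2))
                  - ((w1 * ex + w2) - (w1 * ey + w2)))%R; first by ring.
    by rewrite e1 e2 GRing.subrr.
  have /eqP : (u1 - w1 == 0)%R.
    by move/eqP: e3; rewrite GRing.mulf_eq0 (negPf nexy) orbF.
  move/GRing.subr0_eq => e4; rewrite e4 in e1 *.
  by move/GRing.addrI: e1 => ->.
rewrite -(reindex_inj g_inj (P := xpredT) (F := fun cd : F * F =>
   (rk cd.1 < a) * (rk cd.2 < b))) /=.
rewrite -(pair_bigA _ (fun c d => (rk c < a) * (rk d < b))) /=.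
under eq_bigr do rewrite -big_distrr /= sum_rank_lt //.
by rewrite -big_distrl /= sum_rank_lt.
Qed.

Lemma hash_single x a :
  x < 2 ^ k.+1 -> a <= 2 ^ k.+1 ->
  \sum_(0 <= s < 2 ^ (k.+1 + k.+1)) (hash s x < a) = 2 ^ k.+1 * a.
Proof.
(* The one-point count is the two-point count with every value allowed at a second point: [y] is [1]
   if [x] is [0], and [0] otherwise. *)
move=> ltx lea; pose y : nat := x == 0.
have lty : y < 2 ^ k.+1.
  by apply: leq_ltn_trans (leq_b1 _) _; rewrite -{1}(expn0 2) ltn_exp2l.
rewrite mulnC -(@hash_pair x y a (2 ^ k.+1)) //; last by rewrite /y; case: x {y ltx lty}.
by apply: eq_bigr => s _; rewrite hash_lt muln1.
Qed.

End Hash.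

(** * Luby's step under pairwise independence *)

Section Luby.

Variables (V : finType) (id : V -> nat) (e : rel V) (k : nat).
Hypotheses (e_sym : symmetric e) (e_irr : irreflexive e).
Hypothesis id_inj : injective id.
Local Notation N := (2 ^ k.+1).
Hypotheses (id_lt : forall v, id v < N) (card_le : 4 * #|V| <= N).

Definition deg (v : V) : nat := #|e v|.
(** A mark has probability [quota d / N]. Division by zero gives quota [0] for [d = 0], so isolated
    nodes are never marked. *)
Definition quota (d : nat) : nat := N %/ (4 * d).
Local Notation q v := (quota (deg v)).
Definition marked (s : nat) (v : V) : bool := hash k s (id v) < q v.
Definition joins (s : nat) (v : V) : bool :=
  marked s v && ~~ [exists u, [&& e v u, deg v <= deg u & marked s u]].
Definition lower (v u : V) : bool := e v u && (deg u <= deg v).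
(* The lower neighbours are trimmed, in the order of identifiers, so that the
   expected number of marked ones is at most 1/2. *)
Definition chosen (v u : V) : bool :=
  lower v u && (2 * (\sum_(w | lower v w && (id w <= id u)) q w) <= N).
Definition weight (v : V) : nat := \sum_(u | chosen u v) deg u.
Definition hits (s : nat) (v : V) : nat := \sum_(u | chosen v u) marked s u.
Definition dominated (s : nat) (v : V) : bool := [exists u, e v u && joins s u].

Local Notation sumq v := (\sum_(u | chosen v u) q u).
Local Notation seeds := (2 ^ (k.+1 + k.+1)).

Lemma quota_le d : 4 * (d * quota d) <= N.
Proof. by rewrite mulnA mulnC leq_divM. Qed.

Lemma quota_small d : 4 * quota d <= N.
Proof.
case: d => [|d]; first by rewrite /quota divn0.
by apply: leq_trans (quota_le d.+1); rewrite leq_mul2l leq_pmull.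
Qed.

Lemma quota_leN d : quota d <= N.
Proof. by apply: leq_trans (quota_small d); apply: leq_pmull. Qed.

Lemma deg_le v : deg v <= #|V|.
Proof. exact: max_card. Qed.

Lemma lower_card v : #|lower v| <= deg v.
Proof. by apply/subset_leq_card/subsetP => u; rewrite !unfold_in => /andP[]. Qed.

(** By [card_le] the quotient is at least one, so rounding down loses at most a factor of two. *)
Lemma quota_ge v : 0 < deg v -> N <= 8 * (deg v * q v).
Proof.
move=> d_gt0; rewrite /quota; set n := N.
have: 4 * deg v <= n by apply: leq_trans card_le; rewrite leq_mul2l deg_le.
have := ltn_ceil n (_ : 0 < 4 * deg v); rewrite muln_gt0 d_gt0 => /(_ isT).
case: (n %/ _) => [|x]; nia.
Qed.

Lemma quota_anti d d' : 0 < d -> d <= d' -> quota d' <= quota d.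
Proof. by move=> d_gt0 dd'; apply: leq_div2l; rewrite ?muln_gt0 ?leq_mul2l. Qed.

Lemma sum_marked u : \sum_(0 <= s < seeds) marked s u = N * q u.
Proof. by rewrite /marked hash_single ?quota_leN. Qed.

Lemma sum_marked2 u w : u != w ->
  \sum_(0 <= s < seeds) marked s u * marked s w = q u * q w.
Proof. by move=> uw; rewrite /marked hash_pair ?quota_leN ?(inj_eq id_inj). Qed.

(** Union bound over the neighbours [w] that could block [u]: each costs at most [q u * q w] seeds
    by pairwise independence, and these [q w] sum to at most [deg u * q u <= N / 4]. *)
Lemma sum_joins u : 3 * (N * q u) <= 4 * \sum_(0 <= s < seeds) joins s u.
Proof.
have: N * q u <= \sum_(0 <= s < seeds) joins s u
                + \sum_(w | e u w && (deg u <= deg w)) q u * q w.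
  rewrite -sum_marked.
  under [X in _ <= _ + X]eq_bigr => w /andP[uw _].
    rewrite -sum_marked2; last by apply: contraTneq uw => ->; rewrite e_irr.
    over.
  rewrite exchange_big -big_split /=; apply: leq_sum => s _.
  rewrite /joins; case: (boolP (marked s u)) => //= _.
  case: existsP => [[w /and3P[uw duw mw]]|//].
  by rewrite (bigD1 w) ?uw //= mw.
have: 4 * (\sum_(w | e u w && (deg u <= deg w)) q u * q w) <= N * q u.
  rewrite -big_distrr /= mulnCA [N * _]mulnC leq_mul2l.
  apply/orP; right; have [d0|d_gt0] := posnP (deg u).
    rewrite big_pred0 // => w; apply: contra_eqF d0 => /andP[uw _].
    by rewrite -lt0n; apply/card_gt0P; exists w.
  apply: leq_trans (quota_le (deg u)); rewrite leq_mul2l /=.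
  apply: (@leq_trans (\sum_(w | e u w && (deg u <= deg w)) q u)).
    by apply: leq_sum => w /andP[_]; apply: quota_anti.
  rewrite sum_nat_const leq_mul2r; apply/orP; right.
  by apply/subset_leq_card/subsetP => w; rewrite !unfold_in => /andP[].
lia.
Qed.

Lemma chosen_lower v u : chosen v u -> lower v u.
Proof. by case/andP. Qed.

Lemma sumq_le v : 2 * sumq v <= N.
Proof.
case: (pickP (chosen v)) => [u0 u0v|none]; last by rewrite big_pred0.
(* For the chosen node of largest identifier, the trimming condition already counts every chosen
   node. *)
case: (@arg_maxnP _ u0 (chosen v) id u0v) => u uv umax.
have /andP[_] := uv; apply: leq_trans; rewrite leq_mul2l /=.
rewrite [leqRHS](bigID (chosen v)) /= -[leqLHS]addn0; apply: leq_add => //.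
rewrite [leqRHS](eq_bigl (chosen v)) // => w; apply/andP/idP => [[]//|wv].
by rewrite (chosen_lower wv); split=> //; apply: umax.
Qed.

(** If nothing is trimmed, each lower neighbour contributes at least [q v], which is at least
    [N / (8 * deg v)]. Otherwise the first trimmed neighbour pushes the sum above [N / 2] with a
    quota of at most [N / 4], so the chosen ones exceed [N / 4]. *)
Lemma sumq_ge v : N * #|lower v| <= 8 * (deg v * sumq v).
Proof.
have [->|] := posnP #|lower v|; first by rewrite muln0.
move=> /leq_trans/(_ (lower_card v)) dv.
have qdv := quota_ge dv.
have [all_chosen|/forall_inPn[u0 u0l u0c]] := boolP [forall (u | lower v u), chosen v u].
  have: #|lower v| * q v <= sumq v.
    rewrite -sum_nat_const.
    rewrite [leqRHS](eq_bigl (lower v)); last first.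
      move=> u; apply/idP/idP => [/chosen_lower //|uv].
      by move/forall_inP: all_chosen; apply.
    apply: leq_sum => u /andP[vu duv]; apply: quota_anti => //.
    by apply/card_gt0P; exists v; rewrite unfold_in e_sym.
  move=> le; apply: (@leq_trans (8 * (deg v * q v) * #|lower v|)).
    by rewrite leq_mul2r qdv orbT.
  by rewrite -!mulnA !leq_mul2l /= [q v * _]mulnC le orbT.
pose missing u := lower v u && ~~ chosen v u.
have u0m : missing u0 by apply/andP.
case: (@arg_minnP _ u0 missing id u0m) => u /andP[ul uc] umin.
have: N < 2 * (sumq v + q u).
  have /leq_trans : N < 2 * \sum_(w | lower v w && (id w <= id u)) q w.
    by rewrite ltnNge; move: uc; rewrite /chosen ul.
  apply.
  rewrite leq_mul2l /= (bigD1 u) ?ul ?leqnn //= addnC leq_add2r.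
  rewrite [leqRHS](bigID (fun w => id w <= id u)) /= -[leqLHS]addn0.
  apply: leq_add => //; rewrite big_mkcond [leqRHS]big_mkcond.
  apply: leq_sum => w _; case: ifP => // /andP[/andP[wl wu] nwu].
  rewrite wu andbT; case: ifP => // wc.
  have: id u <= id w by apply: umin; rewrite /missing wl wc.
  rewrite leq_eqVlt (inj_eq id_inj) eq_sym (negPf nwu) /= => uw.
  by rewrite leqNgt uw in wu.
have := quota_small (deg u); have := lower_card v.
move: (sumq v) (q u) N => x y n; nia.
Qed.

(** [t * t.-1] counts ordered pairs of distinct marked chosen nodes; pairwise independence bounds
    the sum by the square of [sumq v], and [sumq_le] absorbs one factor. *)
Lemma sum_hits v :
  2 * (\sum_(0 <= s < seeds) hits s v * (hits s v).-1) <= N * sumq v.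
Proof.
have hitsE s : hits s v * (hits s v).-1 =
    \sum_(u | chosen v u) \sum_(w | chosen v w && (w != u)) marked s u * marked s w.
  rewrite {1}/hits big_distrl /=; apply: eq_bigr => u uv.
  rewrite -big_distrr /=; case: (boolP (marked s u)) => // mu.
  by rewrite !mul1n /hits (bigD1 u) //= mu.
under eq_bigr do rewrite hitsE.
rewrite exchange_big /=.
apply: (@leq_trans (2 * (sumq v * sumq v))).
  rewrite leq_mul2l /= big_distrl /=; apply: leq_sum => u uv.
  rewrite exchange_big /= [sumq v](bigID (fun w => w != u)) /= mulnDr.
  apply: leq_trans (leq_addr _ _).
  rewrite big_distrr /=; apply: leq_sum => w /andP[_ wu].
  by rewrite sum_marked2 // eq_sym.
by rewrite mulnA leq_mul2r sumq_le orbT.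
Qed.

(** One end of each edge has degree at most that of the other, so every edge is counted by some
    [lower]. *)
Lemma sum_lower : \sum_v deg v <= 2 * \sum_v #|lower v|.
Proof.
have lowE (v : V) : #|lower v| = \sum_u lower v u.
  rewrite -sum1_card big_mkcond; apply: eq_bigr => u _. 
  by rewrite unfold_in -/(lower v u); case: (lower v u).
rewrite mul2n -addnn {2}(eq_bigr _ (fun v _ => lowE v)) exchange_big /= -big_split /=.
apply: leq_sum => v _; rewrite lowE -big_split /= /deg -sum1_card big_mkcond /=.
apply: leq_sum => u _; rewrite unfold_in /lower [e u v]e_sym; case: (e v u) => //=.
by case: (leqP (deg u) (deg v)) => // /ltnW ->.
Qed.

(** At most [t = hits s v] chosen nodes join. A single join is paid for by domination; for [t >= 2]
    already [t <= t * t.-1]. *)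
Lemma dominated_ge s v :
  \sum_(u | chosen v u) joins s u <= dominated s v + hits s v * (hits s v).-1.
Proof.
have le_hits : \sum_(u | chosen v u) joins s u <= hits s v.
  by apply: leq_sum => u _; rewrite /joins; case: (marked s u) => //=; apply: leq_b1.
have [->//|] := posnP (\sum_(u | chosen v u) joins s u).
rewrite lt0n sum_nat_eq0 => /forall_inPn[u uv ju].
have -> : dominated s v.
  apply/existsP; exists u; have /andP[/andP[-> _] _] := uv.
  by case: joins ju.
case: (hits s v) le_hits => [|[|n]] le_h //=; first exact: leq_trans le_h _.
by apply: leq_trans le_h _; rewrite (leq_trans _ (leq_addl _ _)) // leq_pmulr.
Qed.

(** Double counting passes the credit [deg v] from the chooser to the joiner, who can evaluate its
    own term locally. *)
Lemma sum_weight s :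
  \sum_v weight v * joins s v = \sum_v deg v * \sum_(u | chosen v u) joins s u.
Proof.
under eq_bigr do rewrite /weight big_distrl /=.
rewrite (exchange_big_dep xpredT) //=.
by apply: eq_bigr => v _; rewrite big_distrr.
Qed.

Lemma sum_progress :
  seeds * (\sum_v deg v)
  + 64 * \sum_(0 <= s < seeds) \sum_v deg v * (hits s v * (hits s v).-1) <=
  64 * \sum_(0 <= s < seeds) \sum_v weight v * joins s v.
Proof.
under [X in _ <= 64 * X]eq_bigr do rewrite sum_weight.
rewrite exchange_big [X in _ <= 64 * X]exchange_big /=.
apply: (@leq_trans (seeds * (2 * \sum_v #|lower v|)
   + 64 * \sum_v \sum_(0 <= s < seeds) deg v * (hits s v * (hits s v).-1))).
  by rewrite leq_add2r leq_mul2l sum_lower orbT.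
rewrite mulnA !big_distrr -big_split /=; apply: leq_sum => v _.
rewrite -!big_distrr /= [X in _ <= 64 * (deg v * X)]exchange_big /=.
have := sumq_ge v; have := sum_hits v.
have: 3 * (N * sumq v) <=
    4 * \sum_(u | chosen v u) \sum_(0 <= s < seeds) joins s u.
  rewrite !big_distrr /=; apply: leq_sum => u _; exact: sum_joins.
rewrite expnD.
move: (\sum_(u | chosen v u) \sum_(_ <= s < _) _) (\sum_(_ <= _ < _) _) (sumq v).
move: #|lower v| (deg v) N => l d n a c x h1 h2 h3.
(* Joins yield at least [3/4] and collisions cost at most [1/2] of [N * sumq v]. The remaining
   quarter, the [8] of [sumq_ge] and the [2] of [sum_lower] make [64]. *)
have h4 : n * x <= 4 * a - 4 * c by lia.
have : 8 * d * (n * x) <= 8 * d * (4 * a - 4 * c) by rewrite leq_mul2l h4 orbT.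
have : n * (n * l) <= n * (8 * (d * x)) by rewrite leq_mul2l h3 orbT.
nia.
Qed.

(** A seed no worse than average inherits the averaged bound [sum_progress], and [dominated_ge]
    turns its score into dominated degree. *)
Lemma progress s bonus malus :
  bonus = \sum_(0 <= s' < seeds) \sum_v weight v * joins s' v ->
  malus = \sum_(0 <= s' < seeds) \sum_v deg v * (hits s' v * (hits s' v).-1) ->
  bonus + seeds * (\sum_v deg v * (hits s v * (hits s v).-1)) <=
    seeds * (\sum_v weight v * joins s v) + malus ->
  \sum_v deg v <= 64 * \sum_(v | dominated s v) deg v.
Proof.
move=> bE mE; have := sum_progress; rewrite -bE -mE => h1 h2.
have h3 : \sum_v weight v * joins s v <= \sum_(v | dominated s v) deg v
            + \sum_v deg v * (hits s v * (hits s v).-1).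
  rewrite sum_weight [X in _ <= X + _]big_mkcond /= -big_split /=; apply: leq_sum => v _.
  apply: leq_trans (leq_mul (leqnn _) (dominated_ge s v)) _.
  by rewrite mulnDr; case: dominated; rewrite ?muln1 ?muln0.
have seeds_gt0 : 0 < seeds by rewrite expn_gt0.
rewrite -(leq_pmul2l seeds_gt0).
move: seeds h1 h2 seeds_gt0 => n h1 h2 _.
have := leq_mul (leqnn n) h3.
lia.
Qed.

End Luby.

(** * One derandomised phase in the network *)

(* The status of a node is [None] while it is active. *)
Definition phase (k : nat) (tot : nat -> prog nat) (x : nat) (nbrs : seq nat)
    (st : option bool) : prog (option bool) :=
  Comm (fun=> nat_of_bool (st == None)) (fun ra =>
  let A := [seq j <- nbrs | (st == None) && (ra j == 1)] in
  let d := size A in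
  Comm (fun=> d) (fun rd =>
  let S := [seq j <- A | (rd j <= d) &&
             (2 * (\sum_(i <- A | (rd i <= d) && (i <= j)) quota k (rd i))
              <= 2 ^ k.+1)] in
  Comm (fun j => if j \in S then d else 0) (fun rw =>
  let W := \sum_(j <- nbrs) rw j in
  let X s j c := hash k s j < quota k c in
  let J s := X s x d && ~~ has (fun j => (d <= rd j) && X s j (rd j)) A in
  let H s := \sum_(j <- S) X s j (rd j) in
  bind (derand tot (k.+1 + k.+1) 0 (fun s => W * J s)
               (fun s => d * (H s * (H s).-1))) (fun s =>
  Comm (fun=> nat_of_bool (J s)) (fun rj =>
  Ret (if st == None then
         if J s then Some true
         else if has (fun j => rj j == 1) nbrs then Some false else None
       else st)))))).

Fixpoint phases (k : nat) (tot : nat -> prog nat) (x : nat) (nbrs : seq nat)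
    (n : nat) (st : option bool) : prog (option bool) :=
  if n is n'.+1 then bind (phase k tot x nbrs st) (phases k tot x nbrs n')
  else Ret st.

Section Phase.

Variables (V : finType) (adj : rel V) (id : V -> nat).
Hypotheses (adj_sym : symmetric adj) (adj_irr : irreflexive adj).
Hypothesis (id_inj : injective id).
Variables (root : V) (depth : nat) (par : V -> option nat) (lev : V -> nat).
Hypothesis root_ball : forall v, v \in ball adj depth root.
Hypothesis treeP : tree_parent adj id root par depth lev.
Variables (b k : nat).
Hypothesis (id_lt : forall v, id v < 2 ^ k.+1).
Hypothesis (card_le : 4 * #|V| <= 2 ^ k.+1).
Hypothesis b_ge : 2 ^ (k.+1 + k.+1) * (#|V| ^ 3 + #|V| ^ 4) <= b.

Local Notation nb := (nbr_ids adj id).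
Local Notation tot v := (tree_sum (nb v) (v == root) (odflt 0 (par v)) depth).

Definition active_adj (U : {set V}) : rel V :=
  fun v u => [&& v \in U, u \in U & adj v u].

Lemma active_sym U : symmetric (active_adj U).
Proof. by move=> v u; rewrite /active_adj adj_sym andbCA. Qed.

Lemma active_irr U : irreflexive (active_adj U).
Proof. by move=> v; rewrite /active_adj adj_irr !andbF. Qed.

Lemma deg_active0 (U : {set V}) v : v \notin U -> deg (active_adj U) v = 0.
Proof.
by move=> vU; apply/eq_card0 => u; rewrite unfold_in /active_adj (negPf vU).
Qed.

Lemma marked_active (U : {set V}) s v : marked id (active_adj U) k s v -> v \in U.
Proof.
apply: contraTT => vU.
by rewrite /marked deg_active0 // /quota muln0 divn0 ltn0.
Qed.

Definition new_status (U : {set V}) (s : nat) (st : V -> option bool) (v : V) :=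
  if v \in U then
    if joins id (active_adj U) k s v then Some true
    else if dominated id (active_adj U) k s v then Some false else None
  else st v.

Lemma card_root_gt0 : 0 < #|V|.
Proof. by apply/card_gt0P; exists root. Qed.

Lemma card_leb : #|V| <= b.
Proof.
apply: leq_trans b_ge; have := card_root_gt0.
have: 0 < 2 ^ (k.+1 + k.+1) by rewrite expn_gt0.
move: #|V| (2 ^ _) => n m m0 n0.
apply: (@leq_trans (1 * (n ^ 3 + n ^ 4))); last by rewrite leq_mul2r m0 orbT.
by rewrite mul1n (leq_trans _ (leq_addr _ _)) // -{1}(expn1 n) leq_pexp2l.
Qed.

Lemma exec_phase (U : {set V}) (st : V -> option bool) :
  (forall v, (st v == None) = (v \in U)) ->
  exists s,
    exec adj id b (4 + (k.+1 + k.+1) * (4 * depth))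
      (fun v => phase k (tot v) (id v) (nb v) (st v)) (new_status U s st)
    /\ \sum_v deg (active_adj U) v <=
       64 * \sum_(v | dominated id (active_adj U) k s v) deg (active_adj U) v.
Proof.
move=> stU.
pose e := active_adj U.
pose m1 (v : V) (j : nat) := nat_of_bool (st v == None).
pose A v := [seq j <- nb v | (st v == None) && (recv adj id m1 v j == 1)].
have condA v u : adj v u ->
    (st v == None) && (recv adj id m1 v (id u) == 1) = (v \in U) && (u \in U).
  by move=> vu; rewrite recvE // /m1 !stU; case: (u \in U).
have mem_A v u : (id u \in A v) = e v u.
  rewrite mem_filter id_nbr // /e /active_adj.
  by case vu: (adj v u); rewrite ?andbF // !andbT condA.
have big_A (v : V) (P : pred nat) (F : nat -> nat) :
    \sum_(j <- A v | P j) F j = \sum_(u | e v u && P (id u)) F (id u).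
  rewrite big_filter_cond big_nbr; apply: eq_bigl => u.
  by rewrite /e /active_adj; case vu: (adj v u); rewrite ?andbF // condA ?andbT ?andbA.
have size_A v : size (A v) = deg e v.
  by rewrite -sum1_size big_A /deg -sum1_card; apply: eq_bigl => u; rewrite andbT.
pose m2 (v : V) (j : nat) := size (A v).
have m2E v u : adj v u -> recv adj id m2 v (id u) = deg e u.
  by move=> vu; rewrite recvE // /m2 size_A.
have m2e v u : e v u -> recv adj id m2 v (id u) = deg e u.
  by case/and3P => _ _; apply: m2E.
pose rd v := recv adj id m2 v.
pose S v := [seq j <- A v | (rd v j <= size (A v)) &&
             (2 * (\sum_(i <- A v | (rd v i <= size (A v)) && (i <= j)) quota k (rd v i))
              <= 2 ^ k.+1)].
have condS v u : e v u ->
   (rd v (id u) <= size (A v)) &&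
     (2 * (\sum_(i <- A v | (rd v i <= size (A v)) && (i <= id u)) quota k (rd v i))
      <= 2 ^ k.+1) = chosen id e k v u.
  move=> vu; rewrite /chosen /lower vu /= /rd m2e // size_A; congr (_ && (2 * _ <= _)).
  rewrite big_A; apply: eq_big => [w|w /andP[vw _]]; last by rewrite m2e.
  by case vw: (e v w) => //=; rewrite m2e.
have mem_S v u : (id u \in S v) = chosen id e k v u.
  rewrite mem_filter mem_A; case vu: (e v u); first by rewrite condS ?andbT.
  by rewrite andbF /chosen /lower vu.
have big_S (v : V) (F : nat -> nat) :
    \sum_(j <- S v) F j = \sum_(u | chosen id e k v u) F (id u).
  rewrite big_filter big_A; apply: eq_bigl => u.
  case vu: (e v u); first by rewrite condS.
  by rewrite /chosen /lower vu.
pose m3 (v : V) (j : nat) := if j \in S v then size (A v) else 0.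
pose W v := \sum_(j <- nb v) recv adj id m3 v j.
(* Every node sends its degree to exactly the nodes it chose, so what [v] receives adds up to its
   weight. *)
have WE v : W v = weight id e k v.
  rewrite /W (big_recv adj id_inj addn) /weight /= /m3.
  rewrite -big_mkcondr; apply: eq_big => [u|u _]; last by rewrite size_A.
  rewrite mem_S andb_idl // => /andP[/andP[/and3P[_ _]]].
  by rewrite adj_sym.
pose X s j c := hash k s j < quota k c.
pose J v s := X s (id v) (size (A v)) &&
   ~~ has (fun j => (size (A v) <= rd v j) && X s j (rd v j)) (A v).
have JE v s : J v s = joins id e k s v.
  rewrite /J /joins /X size_A; congr (_ && ~~ _).
  apply/hasP/existsP => [[j]|[u /and3P[vu duv mu]]].
    rewrite mem_filter => /andP[/andP[vU ju] /mem_nbr[u vu jE]].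
    rewrite jE in ju *.
    rewrite {1 2}/rd m2E // => /andP[duv mu].
    exists u; apply/and3P; split=> //; apply/and3P; split=> //; first by rewrite -stU.
    by move: ju; rewrite recvE // /m1 stU; case: (u \in U).
  by exists (id u); rewrite ?mem_A // /rd m2e // duv.
pose H v s := \sum_(j <- S v) X s j (rd v j).
have HE v s : H v s = hits id e k s v.
  rewrite /H big_S; apply: eq_bigr => u /chosen_lower/andP[vu _].
  by rewrite /X /rd m2e.
have sum_le (F : V -> nat) c : (forall v, F v <= c) -> \sum_v F v <= #|V| * c.
  by move=> Fc; rewrite -sum_nat_const; apply: leq_sum.
have W_le v : W v <= #|V| * #|V|.
  rewrite WE /weight; apply: leq_trans (sum_le (deg e) _ (deg_le e)).
  by rewrite [leqRHS](bigID (fun u => chosen id e k u v)) leq_addr.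
have H_le v s : H v s <= #|V|.
  rewrite HE /hits -[leqRHS]muln1 -sum_nat_const big_mkcond /=.
  by apply: leq_sum => u _; case: ifP => // _; apply: leq_b1.
(* A weight is at most [#|V| ^ 2] and a degree times [t * t.-1] at most [#|V| ^ 3]; summing over the
   nodes adds one factor. *)
have leP s : \sum_v W v * J v s <= #|V| ^ 3.
  rewrite !expnS expn0 muln1; apply: sum_le => v.
  by rewrite -[leqRHS]muln1 leq_mul ?leq_b1.
have leQ s : \sum_v size (A v) * (H v s * (H v s).-1) <= #|V| ^ 4.
  rewrite !expnS expn0 muln1; apply: sum_le => v.
  by rewrite size_A leq_mul ?deg_le // leq_mul // (leq_trans (leq_pred _)).
have [s [exs les]] := exec_derand adj_sym id_inj root_ball treeP 0 leP leQ b_ge.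
have EP s' : \sum_v W v * J v s' = \sum_v weight id e k v * joins id e k s' v.
  by apply: eq_bigr => v _; rewrite WE JE.
have EQ s' : \sum_v size (A v) * (H v s' * (H v s').-1) =
             \sum_v deg e v * (hits id e k s' v * (hits id e k s' v).-1).
  by apply: eq_bigr => v _; rewrite HE size_A.
exists s; split; last first.
  rewrite EP EQ in les.
  apply: (progress (active_sym U) (active_irr U) id_inj id_lt card_le _ _ les).
    by apply: eq_bigr => s' _; rewrite EP.
  by apply: eq_bigr => s' _; rewrite EQ.
rewrite (_ : 4 + _ = ((k.+1 + k.+1) * (4 * depth) + 1).+3); last first.
  by rewrite addnC addn1 addn4.
apply: exec_round => [v u _|];
  first exact: leq_trans (leq_b1 _) (leq_trans card_root_gt0 card_leb).
apply: exec_round => [v u _|].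
  by rewrite -/(A v) size_A (leq_trans (deg_le _ _)) ?card_leb.
apply: exec_round => [v u _|].
  by case: ifP => // _; rewrite -/(A v) size_A (leq_trans (deg_le _ _)) ?card_leb.
apply: exec_bind exs _.
apply: exec_round => [v u _|];
  first exact: leq_trans (leq_b1 _) (leq_trans card_root_gt0 card_leb).
apply: exec_ret => v; congr Ret.
pose m4 (u : V) (j : nat) := nat_of_bool (J u s).
transitivity (if st v == None then if J v s then Some true
    else if has (fun j => recv adj id m4 v j == 1) (nb v) then Some false else None
  else st v); first by [].
rewrite /new_status stU; case: ifP => // vU; rewrite JE; case: ifP => // _.
congr (if _ then _ else _); apply/hasP/existsP => [[j /mem_nbr[u vu ->]]|[u]].
  rewrite recvE // /m4 JE => ju; exists u.
  have {}ju : joins id e k s u by case: (joins _ _ _ _ _) ju.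
  rewrite ju andbT; apply/and3P; split=> //.
  by have /andP[/marked_active] := ju.
case/andP=> /and3P[_ _ vu] ju; exists (id u); first by rewrite id_nbr.
by rewrite recvE // /m4 JE ju.
Qed.

End Phase.

(** * Shrinking the active graph *)

(** Bernoulli's inequality for [(1 + 1/m) ^ p], with denominators cleared. *)
Lemma bernoulli m p : m ^ p * (m + p) <= m.+1 ^ p * m.
Proof.
elim: p => [|p IH]; first by rewrite !mul1n addn0.
rewrite !expnS; apply: (@leq_trans (m.+1 * (m ^ p * (m + p)))).
  rewrite mulnAC [m ^ p * _]mulnC mulnA leq_mul2r; apply/orP; right; nia.
by rewrite -mulnA leq_mul2l IH orbT.
Qed.

(** Bernoulli at exponent [m.+1] gives [(1 + 1/m) ^ m.+1 >= 2], so each block of [m.+1] shrinking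
    steps halves the quantity. *)
Lemma halving m j x y : 0 < m ->
  m.+1 ^ (m.+1 * j) * x <= m ^ (m.+1 * j) * y -> 2 ^ j * x <= y.
Proof.
move=> m_gt0 le_xy.
have h : 2 * m ^ m.+1 <= m.+1 ^ m.+1.
  rewrite -(leq_pmul2r m_gt0); apply: leq_trans (bernoulli m m.+1).
  by rewrite -mulnA mulnCA leq_mul2l; apply/orP; right; lia.
have pos : 0 < m ^ (m.+1 * j) by rewrite expn_gt0 m_gt0.
rewrite -(leq_pmul2l pos); apply: leq_trans le_xy.
rewrite mulnA leq_mul2r; apply/orP; right.
case: j {pos} => [|j]; first by rewrite !muln0.
by rewrite mulnC !expnM -expnMn leq_exp2r.
Qed.

(** This [k] makes [2 ^ k.+1 >= 4 * M.+1], enough for all identifiers and for [4 * #|V|] when [M] is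
    the largest identifier. Every 64 phases halve the edge count, and [k.+1 + k.+1] halvings beat
    [#|V| ^ 2]. Nodes active at the end are then isolated among themselves, so [None] also means
    membership. *)
Definition mis (depth M x : nat) (nbrs : seq nat) : prog bool :=
  let k := (trunc_log 2 M).+2 in
  bind (bfs nbrs depth (if x == M then Some 0 else None)) (fun par =>
  bind (phases k (tree_sum nbrs (x == M) (odflt 0 par) depth) x nbrs
               (64 * (k.+1 + k.+1)) None)
       (fun st => Ret (st != Some false))).

(* Success requires a node that is the maximum of its ball and sees no
   disagreement about the maximum inside that ball; see [certified_ball]. *)
Definition attempt (depth x : nat) (nbrs : seq nat) : prog (option bool) :=
  bind (flood nbrs depth x) (fun M =>
  Comm (fun=> M) (fun r =>
  bind (flood nbrs depth (nat_of_bool (has (fun j => r j != M) nbrs))) (fun bad =>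
  bind (flood nbrs depth (nat_of_bool ((x == M) && (bad == 0)))) (fun ok =>
  if ok == 0 then Ret None
  else bind (mis depth M x nbrs) (fun c => Ret (Some c)))))).

Section Correctness.

Variables (V : finType) (adj : rel V) (id : V -> nat).
Hypotheses (adj_sym : symmetric adj) (adj_irr : irreflexive adj).
Hypothesis (id_inj : injective id).

Local Notation nb := (nbr_ids adj id).
Local Notation edges U := (\sum_v deg (active_adj adj U) v).

Definition partial_MIS (U I : {set V}) : Prop :=
  [/\ independent adj I,
      forall u v, u \in I -> adj u v -> v \notin U,
      forall v, v \notin U -> v \notin I -> exists u, (u \in I) && adj v u
    & forall v, v \in I -> v \notin U].

Definition status (U I : {set V}) (v : V) : option bool :=
  if v \in U then None else Some (v \in I).

Section Step.

Variables (U I : {set V}) (k s : nat).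
Local Notation e := (active_adj adj U).
Local Notation joins := (joins id e k s).
Local Notation dominated := (dominated id e k s).

Definition next_active := [set v in U | ~~ joins v && ~~ dominated v].
Definition next_MIS := I :|: [set v | joins v].

Lemma joins_active v : joins v -> v \in U.
Proof. by case/andP=> /marked_active. Qed.

Lemma next_status :
  (forall v, v \in I -> v \notin U) ->
  new_status adj id k U s (status U I) = status next_active next_MIS.
Proof.
move=> IU; apply: functional_extensionality => v.
rewrite /new_status /status !inE; case: (boolP (v \in U)) => vU /=.
  case jv: (joins v); first by rewrite orbT.
  by case: dominated => //=; rewrite orbF (contraTF (IU v)).
by rewrite [joins v](contraNF (@joins_active v)) // orbF.
Qed.

Lemma partial_MIS_next : partial_MIS U I -> partial_MIS next_active next_MIS.
Proof.
case=> indI IU maxI disj.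
(* Of two adjacent joining nodes, the one of smaller or equal degree would be blocked by the other's
   mark. *)
have joins_adj u v : joins u -> joins v -> deg e u <= deg e v -> ~~ adj u v.
  move=> ju jv duv; apply/negP => uv.
  have /andP[_ /existsP[]] := ju; exists v; apply/and3P; split=> //.
    by apply/and3P; rewrite !joins_active.
  by case/andP: jv.
split.
- move=> u v; rewrite !inE => /orP[uI|ju] /orP[vI|jv]; first exact: indI.
  + by apply/negP => /(IU u v uI); rewrite joins_active.
  + by rewrite adj_sym; apply/negP => /(IU v u vI); rewrite joins_active.
  case/orP: (leq_total (deg e u) (deg e v)); first exact: joins_adj.
  by rewrite adj_sym; apply: joins_adj.
- move=> u v; rewrite !inE => /orP[uI|ju] uv; first by rewrite (negPf (IU u v uI uv)).
  apply/negP => /and3P[vU _ /existsP[]]; exists u; rewrite ju andbT.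
  by rewrite /active_adj vU joins_active // adj_sym.
- move=> v; rewrite !inE negb_or => vU' /andP[vI jv].
  have [vU|vU] := boolP (v \in U); last first.
    by have [u /andP[uI vu]] := maxI v vU vI; exists u; rewrite !inE uI.
  move: vU'; rewrite vU jv /= negbK => /existsP[u /andP[/and3P[_ _ vu] ju]].
  by exists u; rewrite !inE ju orbT.
- move=> v; rewrite !inE => /orP[/disj/negPf->//|->].
  by rewrite andbF.
Qed.

(** Dominated nodes leave, so their degrees, at least [1/64] of the total, disappear. *)
Lemma edges_next :
  edges U <= 64 * \sum_(v | dominated v) deg e v ->
  64 * edges next_active <= 63 * edges U.
Proof.
have: edges next_active + \sum_(v | dominated v) deg e v <= edges U.
  rewrite [X in _ + X]big_mkcond -big_split /=; apply: leq_sum => v _.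
  case: ifP => dv.
    by rewrite deg_active0 // !inE dv !andbF.
  rewrite addn0; apply/subset_leq_card/subsetP => u /and3P[].
  by rewrite !inE => /andP[vU _] /andP[uU _] vu; apply/and3P.
lia.
Qed.

End Step.

Lemma edges_max U : edges U <= #|V| * #|V|.
Proof. by rewrite -sum_nat_const; apply: leq_sum => v _; apply: deg_le. Qed.

(** No active node is adjacent to [I], and without active edges no two active nodes are adjacent, so
    all of them can be added. *)
Lemma partial_MIS_final U I :
  partial_MIS U I -> edges U = 0 -> is_MIS adj (U :|: I).
Proof.
case=> indI IU maxI disj /eqP; rewrite sum_nat_eq0 => /forallP noedge.
have indU u v : u \in U -> v \in U -> ~~ adj u v.
  move=> uU vU; apply/negP => uv; have := noedge u; rewrite -leqn0 leqNgt.
  by case/negP; apply/card_gt0P; exists v; rewrite unfold_in /active_adj uU vU.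
split=> [u v|v]; rewrite !inE.
  case/orP=> [uU|uI] /orP[vU|vI]; [exact: indU| | |exact: indI].
    by rewrite adj_sym; apply/negP => /(IU v u vI); rewrite uU.
  by apply/negP => /(IU u v uI); rewrite vU.
rewrite negb_or => /andP[vU vI]; have [u /andP[uI vu]] := maxI v vU vI.
by exists u; rewrite !inE uI orbT.
Qed.

Section WithRoot.

Variables (root : V) (depth b : nat).
Hypothesis root_ball : forall v, v \in ball adj depth root.
Hypothesis root_max : forall v, id v <= id root.
Local Notation k := (trunc_log 2 (id root)).+2.
Hypothesis b_ge : 2 ^ (k.+1 + k.+1) * (#|V| ^ 3 + #|V| ^ 4) <= b.

Definition phase_time := 4 + (k.+1 + k.+1) * (4 * depth).

Lemma id_root_lt : 4 * (id root).+1 <= 2 ^ k.+1.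
Proof. by rewrite 2!expnS mulnA; apply: leq_mul => //; apply: trunc_log_ltn. Qed.

Lemma id_lt_field v : id v < 2 ^ k.+1.
Proof.
by apply: leq_trans id_root_lt; apply: leq_trans (leq_pmull _ _); rewrite ?ltnS.
Qed.

Lemma card_le_field : 4 * #|V| <= 2 ^ k.+1.
Proof.
apply: leq_trans id_root_lt; rewrite leq_mul2l /= -(card_ord (id root).+1).
pose f v : 'I_(id root).+1 := inord (id v).
apply: (@leq_card _ _ f) => u v /(congr1 val) /=.
by rewrite !inordK ?ltnS ?root_max // => /id_inj.
Qed.

Lemma exec_phases par lev n U I :
  tree_parent adj id root par depth lev ->
  partial_MIS U I ->
  exists U' I',
    [/\ exec adj id b (n * phase_time)
          (fun v => phases k (tree_sum (nb v) (v == root) (odflt 0 (par v)) depth)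
                      (id v) (nb v) n (status U I v))
          (status U' I'),
        partial_MIS U' I'
      & 64 ^ n * edges U' <= 63 ^ n * edges U].
Proof.
move=> treeP; elim: n U I => [|n IH] U I pmis.
  by exists U, I; split=> //; exact: exec_ret.
have [|s [exs les]] := exec_phase adj_sym adj_irr id_inj root_ball treeP
   id_lt_field card_le_field b_ge (U := U) (st := status U I).
  by move=> v; rewrite /status; case: ifP.
have [_ _ _ disj] := pmis.
rewrite next_status // in exs.
have [U' [I' [exn pmis' le']]] := IH _ _ (partial_MIS_next k s pmis).
exists U', I'; split=> //; first by rewrite mulSn; apply: exec_bind exs exn.
rewrite !expnS -mulnA; apply: leq_trans (leq_mul (leqnn 64) le') _.
rewrite mulnCA -[leqRHS]mulnA [leqRHS]mulnCA leq_mul2l; apply/orP; right.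
exact: edges_next les.
Qed.

Lemma exec_mis :
  exists I, is_MIS adj I /\
    exec adj id b (depth + 64 * (k.+1 + k.+1) * phase_time)
      (fun v => mis depth (id root) (id v) (nb v)) (fun v => v \in I).
Proof.
have b_gt0 : 0 < b := leq_trans (card_root_gt0 root) (card_leb root b_ge).
have [par [lev [exb treeP]]] := exec_bfs adj_sym id_inj root depth b_gt0.
have pmis0 : partial_MIS setT set0.
  by split=> [u v|u v|v|v]; rewrite !inE.
have [U [I [exn pmis le]]] := exec_phases (64 * (k.+1 + k.+1)) treeP pmis0.
exists (U :|: I); split.
  apply: partial_MIS_final => //; apply/eqP; rewrite -leqn0 leqNgt.
  apply/negP => e_gt0; have := @halving 63 _ _ _ isT le.
  apply/negP; rewrite -ltnNge.
  apply: leq_ltn_trans (edges_max _) _.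
  apply: (@leq_trans (2 ^ (k.+1 + k.+1))); last by rewrite leq_pmulr.
  have := card_le_field; have := card_root_gt0 root; rewrite expnD.
  by move: #|V| (2 ^ _) => n N n0 nN; apply: ltn_mul; lia.
rewrite -[64 * _ * _]addn0 -[X in depth + (X + 0)]addn0 -addnA.
have exb' : exec adj id b depth
    (fun v => bfs (nb v) depth (if id v == id root then Some 0 else None)) par.
  by apply: exec_eq exb => v; rewrite (inj_eq id_inj).
apply: exec_bind exb' _.
apply: (@exec_bind _ _ _ _ _ _ _ _ _ (status U I)).
  by apply: exec_eq exn => v; rewrite (inj_eq id_inj) /status inE.
apply: exec_ret => v; rewrite /status inE; congr Ret.
by case: ifP => //= _; case: (v \in I).
Qed.

End WithRoot.

End Correctness.

(** * Guessing the diameter *)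

Section Attempt.

Variables (V : finType) (adj : rel V) (id : V -> nat).
Hypotheses (adj_sym : symmetric adj) (adj_irr : irreflexive adj).
Hypothesis (id_inj : injective id).
Variable depth : nat.

Local Notation nb := (nbr_ids adj id).

Definition max_id v := \max_(u in ball adj depth v) id u.
Definition conflict v := [exists u, adj v u && (max_id u != max_id v)].
Definition certified v :=
  (id v == max_id v) && (\max_(u in ball adj depth v) conflict u == 0).

(* If [u] is adjacent to the ball of a certified [r], then [u] agrees that [r] is
   its maximum, which puts [u] itself into that ball; by connectivity the ball
   is everything. *)
Lemma certified_ball r : connected adj -> certified r ->
  forall v, v \in ball adj depth r /\ max_id v = id r.
Proof.
move=> conn /andP[/eqP rmax noconf] v.
pose good u := u \in ball adj depth r /\ max_id u = id r.
have step u w : good u -> adj u w -> good w.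
  case=> ur umax uw.
  have wmax : max_id w = id r.
    rewrite -umax; apply/eqP; apply: contraTT noconf => wu.
    rewrite -lt0n; apply: leq_trans (leq_bigmax_cond u ur).
    by rewrite lt0b; apply/existsP; exists w; rewrite uw.
  split=> //; rewrite ball_sym //.
  have [|x xw] := @eq_bigmax_cond _ (mem (ball adj depth w)) id.
    by apply/card_gt0P; exists w; apply: ball_refl.
  by move: wmax; rewrite /max_id => -> /id_inj ->.
suff walk p u : path adj u p -> good u -> good (last u p).
  by have /connectP[p pp ->] := conn r v; apply: walk => //; rewrite /good ball_refl.
elim: p u => //= w p IH u /andP[uw pp] gu.
exact: IH pp (step u w gu uw).
Qed.

(** Once every ball is the whole graph, all nodes agree on the maximum and its owner is
    certified. *)
Lemma certified_exists D :
  0 < #|V| -> (forall u v, v \in ball adj D u) -> D <= depth ->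
  exists r, certified r.
Proof.
move=> V_gt0 diam Dd; have [r rE] := eq_bigmax id V_gt0.
have full u v : v \in ball adj depth u by apply: (subsetP (ball_leq _ _ Dd)).
have maxE v : max_id v = id r.
  by rewrite /max_id -rE; apply: eq_bigl => u; rewrite full.
exists r; rewrite /certified maxE eqxx big1 // => v _.
by rewrite (_ : conflict v = false) //; apply/existsP => -[u]; rewrite !maxE eqxx andbF.
Qed.

Variable b : nat.
Hypothesis b_gt0 : 0 < b.
Hypothesis id_le : forall v, id v <= b.

Lemma exec_attempt T (a : V -> option bool) :
  exec adj id b T (fun v =>
    if \max_(u in ball adj depth v) certified u == 0 then Ret None
    else bind (mis depth (max_id v) (id v) (nb v)) (fun c => Ret (Some c))) a ->
  exec adj id b (depth + (depth + (depth + T)).+1)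
       (fun v => attempt depth (id v) (nb v)) a.
Proof.
move=> exT; apply: exec_bind (exec_flood adj id_inj depth id_le) _.
apply: exec_round => [v u _|]; first by apply/bigmax_leqP.
have confE v : has (fun j => recv adj id (fun u=> fun=> max_id u) v j != max_id v) (nb v)
    = conflict v.
  apply/hasP/existsP => [[j /mem_nbr[u vu ->]]|[u /andP[vu uv]]].
    by rewrite recvE // => uv; exists u; rewrite vu.
  by exists (id u); rewrite ?id_nbr // recvE.
have le_b (B : bool) : B <= b by apply: leq_trans (leq_b1 _) b_gt0.
apply: (@exec_bind _ _ _ _ _ _ _ _ _ (fun v => \max_(u in ball adj depth v) conflict u)).
  apply: exec_eq (exec_flood adj id_inj depth (f := conflict) _) => // v.
  by rewrite -confE.
apply: exec_bind exT.
exact: (exec_flood adj id_inj depth (f := certified)).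
Qed.

Lemma exec_attempt_fail : ~ (exists r, certified r) ->
  exec adj id b (depth + (depth + (depth + 0)).+1)
       (fun v => attempt depth (id v) (nb v)) (fun=> None).
Proof.
move=> none; apply: exec_attempt; apply: exec_ret => v.
rewrite big1 // => u _; case cu: (certified u) => //.
by case: none; exists u.
Qed.

(** The test takes [3 * n + 1] rounds, the BFS [n], and the phases the rest. Here [k] is the
    exponent of the field size, one more than the [k] of [mis]. *)
Definition success_time (n k : nat) :=
  3 * n + 1 + (n + 64 * (k + k) * (4 + (k + k) * (4 * n))).

(** The ball of a certified node is everything, so every node sees the success flag and uses the
    same root: no node gives up while others proceed. *)
Lemma exec_attempt_success r :
  let k := (trunc_log 2 (id r)).+3 in
  connected adj -> certified r ->
  2 ^ (k + k) * (#|V| ^ 3 + #|V| ^ 4) <= b ->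
  exists I, is_MIS adj I /\
    exec adj id b (success_time depth k)
         (fun v => attempt depth (id v) (nb v)) (fun v => Some (v \in I)).
Proof.
move=> k conn cr b_ge; have ballP := certified_ball conn cr.
have rball v : v \in ball adj depth r by case: (ballP v).
have rmax v : id v <= id r.
  have [_ <-] := ballP r; apply: (leq_bigmax_cond v); exact: rball.
have [I [misI exI]] := exec_mis adj_sym adj_irr id_inj rball rmax b_ge.
exists I; split=> //.
set t := depth + 64 * _ * _ in exI.
have -> : success_time depth k = depth + (depth + (depth + (t + 0))).+1.
  rewrite /success_time addn0 addnA.
  by rewrite -[t]/(depth + 64 * (k + k) * (4 + (k + k) * (4 * depth))); lia.
apply: exec_attempt.
apply: (exec_eq (P := fun v =>
  bind (mis depth (id r) (id v) (nb v)) (fun c => Ret (Some c)))).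
  move=> v; have [_ ->] := ballP v; rewrite ifN // -lt0n.
  apply: leq_trans (leq_bigmax_cond r _); first by rewrite cr.
  by rewrite ball_sym.
by apply: exec_bind exI _; apply: exec_ret.
Qed.

End Attempt.

(** * The algorithm as a state machine, and its runs *)

Record machine := Machine {
  round : nat;
  own : nat;
  nbrs : seq nat;
  code : prog (option bool)
}.

Definition start (i x : nat) (s : seq nat) : machine :=
  Machine i x s (attempt (2 ^ i) x s).

Definition luby : algorithm := {|
  state := machine;
  init := start 0;
  send := fun s j => if code s is Comm m _ then Some (encode (m j)) else None;
  step := fun s r =>
    match code s with
    | Comm m k => Machine (round s) (own s) (nbrs s)
                    (k (fun j => if r j is Some c then decode c else 0))
    | Ret None => start (round s).+1 (own s) (nbrs s)
    | Ret (Some _) => s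
    end;
  out := fun s => if code s is Ret c then c else None
|}.

Section Run.

Variables (V : finType) (adj : rel V) (id : V -> nat).
Local Notation nb := (nbr_ids adj id).
Local Notation st t v := (run luby adj id t v).

Definition short_messages (x t : nat) : Prop :=
  forall v u m, adj v u -> send luby (st t v) (id u) = Some m -> size m <= x.+1.

Lemma runS t v :
  st t.+1 v = step luby (st t v)
    (fun j => if [pick u | adj v u && (id u == j)] is Some u
              then send luby (st t u) (id v) else None).
Proof. by []. Qed.

(** Transfers abstract executions to [run]: numbers up to [2 ^ x] fit in [x.+1] bits and are decoded
    exactly. *)
Lemma run_exec x T P a t i :
  exec adj id (2 ^ x) T P a ->
  (forall v, st t v = Machine i (id v) (nb v) (P v)) ->
  (forall v, st (t + T) v = Machine i (id v) (nb v) (Ret (a v))) /\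
  (forall t', t <= t' <= t + T -> short_messages x t').
Proof.
move=> ex; elim: ex t => {T P a} [P a Pa|P m k T a Pm mb ex IH] t stP.
  rewrite addn0; split=> [v|t']; first by rewrite stP Pa.
  by rewrite -eqn_leq => /eqP <- v u m _; rewrite stP Pa.
have [v|fin short] := IH t.+1; last first.
  split=> [v|t' /andP[]]; first by rewrite -addSnnS.
  rewrite leq_eqVlt => /orP[/eqP <- _|lt le]; last first.
    by apply: short; rewrite lt addSnnS.
  move=> v u c vu; rewrite stP Pm /= => -[<-].
  exact: size_encode (mb v u vu).
rewrite runS {1}/step /luby stP Pm /=; congr (Machine _ _ _ (k v _)).
apply: functional_extensionality => j; rewrite /recv.
case: pickP => // u _; rewrite stP Pm /=; exact: encodeK.
Qed.

Lemma out_irrevocable t v c :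
  out luby (st t v) = Some c -> out luby (st t.+1 v) = Some c.
Proof.
rewrite runS; case: (st t v) => i x s [] //= o.
by move=> ->.
Qed.

Lemma done_stable t i (a : V -> bool) :
  (forall v, st t v = Machine i (id v) (nb v) (Ret (Some (a v)))) ->
  forall n v, st (t + n) v = Machine i (id v) (nb v) (Ret (Some (a v))).
Proof.
move=> stt; elim=> [|n IH] v; first by rewrite addn0.
by rewrite addnS runS IH.
Qed.

(* Attempt [i] begins after this many rounds: one silent round separates
   consecutive attempts. *)
Definition start_time i := \sum_(j < i) (3 * 2 ^ j + 2).

Hypotheses (adj_sym : symmetric adj) (adj_irr : irreflexive adj).
Hypothesis (id_inj : injective id).

Lemma run_failures x i :
  (forall v, id v <= 2 ^ x) ->
  (forall j, j < i -> ~ exists r, certified adj id (2 ^ j) r) ->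
  (forall v, st (start_time i) v = start i (id v) (nb v)) /\
  (forall t, t < start_time i -> short_messages x t).
Proof.
move=> idx; elim: i => [|i IH] fail; first by rewrite /start_time big_ord0.
have [j ji|sti short] := IH; first by apply: fail; apply: ltnW.
have x_gt0 : 0 < 2 ^ x by rewrite expn_gt0.
have ex := exec_attempt_fail id_inj x_gt0 idx (fail i (ltnSn i)).
have [fin short'] := run_exec ex sti.
have -> : start_time i.+1 = (start_time i + (2 ^ i + (2 ^ i + (2 ^ i + 0)).+1)).+1.
  by rewrite /start_time big_ord_recr /=; lia.
split=> [v|t]; first by rewrite runS fin.
rewrite ltnS => le; case: (ltnP t (start_time i)) => [|ge]; first exact: short.
by apply: short'; rewrite ge.
Qed.

End Run.

(** * Time and message bounds *)

Lemma start_time_le i : start_time i <= 5 * 2 ^ i.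
Proof.
elim: i => [|i IH]; first by rewrite /start_time big_ord0.
have pos : 0 < 2 ^ i by rewrite expn_gt0.
by rewrite /start_time big_ord_recr /= -/(start_time i) expnS; lia.
Qed.

Lemma success_time_le n k : 0 < n -> 0 < k ->
  success_time n k + 5 * n <= 1546 * (n * k ^ 2).
Proof.
move=> n_gt0 k_gt0; rewrite /success_time expnS expn1.
have: k <= n * (k * k) by rewrite mulnA leq_pmull // muln_gt0 n_gt0.
have: n <= n * (k * k) by rewrite leq_pmulr // muln_gt0 k_gt0.
set z := n * (k * k).
(* The phases contribute [512 + 1024]; the remaining [9 * n + 1] rounds add [9 + 1], which gives
   [1546]. *)
have -> : 64 * (k + k) * (4 + (k + k) * (4 * n)) = 512 * k + 1024 * z by rewrite /z; nia.
lia.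
Qed.

(** The exponents add up to [2 * y] for the seed, [4 * y] for the powers of [n] and [1] for their
    sum, within [8 * y]. *)
Lemma seed_bound n k y : n <= 2 ^ y -> k <= y -> 0 < y ->
  2 ^ (k + k) * (n ^ 3 + n ^ 4) <= 2 ^ (8 * y).
Proof.
move=> ny ky y_gt0.
have le e : 0 < e <= 4 -> n ^ e <= 2 ^ (4 * y).
  case/andP=> e_gt0 e4; apply: (@leq_trans ((2 ^ y) ^ e)); first by rewrite leq_exp2r.
  by rewrite -expnM mulnC leq_exp2l // leq_mul2r e4 orbT.
apply: (@leq_trans (2 ^ (k + k) * (2 ^ (4 * y) + 2 ^ (4 * y)))).
  by rewrite leq_mul2l leq_add ?orbT ?le.
rewrite [X in _ * X]addnn -mul2n -expnS -expnD leq_exp2l //; lia.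
Qed.

Theorem theorem4 :
  forall c : nat,
  exists (A : algorithm) (B C : nat),
  forall (V : finType) (adj : rel V) (id : V -> nat) (D : nat),
    symmetric adj -> irreflexive adj -> connected adj ->
    injective id -> (forall v : V, id v < #|V| ^ c) ->
    is_diameter adj D ->
    (forall (t : nat) (v u : V) (m : seq bool), adj v u ->
       send A (run A adj id t v) (id u) = Some m ->
       size m <= B * (trunc_log 2 #|V|).+1)
    /\ (forall (t : nat) (v : V) (b : bool),
          out A (run A adj id t v) = Some b ->
          out A (run A adj id t.+1 v) = Some b)
    /\ (exists I : {set V}, is_MIS adj I /\
          forall v : V,
            out A (run A adj id (C * D.+1 * (trunc_log 2 #|V|).+1 ^ 2) v)
            = Some (v \in I)).
Proof.
(* [8 * c.+3] is the exponent of [seed_bound] per unit of [l], and [+ 1] covers the extra bit of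
   [size_encode]. [3092] is [2 * 1546], the [2] coming from [2 ^ i <= 2 * D.+1]. *)
move=> c; exists luby, (8 * c.+3 + 1), (3092 * c.+3 ^ 2).
move=> V adj id D adj_sym adj_irr conn id_inj id_lt [diam _].
have [V0|V_gt0] := posnP #|V|.
  have noV (v : V) : False by have := fintype0 v V0.
  split=> [t v|]; first by case: (noV v).
  split=> [t v|]; first by case: (noV v).
  exists set0; split=> [|v]; last by case: (noV v).
  by split=> [u|u]; case: (noV u).
set l := (trunc_log 2 #|V|).+1.
(* Identifiers lie below [2 ^ (c * l)], and the field exponent exceeds the logarithm of the largest
   one by [3], hence [c.+3]. *)
pose y := c.+3 * l; pose x := 8 * y.
have l_gt0 : 0 < l by [].
have y_gt0 : 0 < y by rewrite muln_gt0.
have card_lt : #|V| < 2 ^ l by apply: trunc_log_ltn.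
have id_lt2 v : id v < 2 ^ (c * l).
  apply: leq_trans (id_lt v) _; rewrite mulnC expnM.
  by case: (c) => // c'; rewrite leq_exp2r // ltnW.
have id_le v : id v <= 2 ^ x.
  by apply: leq_trans (ltnW (id_lt2 v)) _; rewrite leq_exp2l // /x /y; nia.
pose cert i := [exists r, certified adj id (2 ^ i) r].
have ex_cert : exists i, cert i.
  exists D; apply/existsP; apply: certified_exists V_gt0 diam _.
  exact: ltnW (ltn_expl _ _).
(* The first guess with a certified node succeeds; all earlier ones fail at every node. *)
case: (ex_minnP ex_cert) => i /existsP[r cr] imin.
have [j ji|sti short] := @run_failures V adj id id_inj x i id_le.
  by move=> /existsP/imin; rewrite leqNgt ji.
pose k := (trunc_log 2 (id r)).+3.
have ky : k <= y.
  have: trunc_log 2 (id r) <= c * l.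
    by rewrite -[leqRHS](@trunc_expnK 2) // leq_trunc_log // ltnW.
  by rewrite /k /y mulSn !addSn; nia.
have Vy : #|V| <= 2 ^ y.
  by apply: leq_trans (ltnW card_lt) _; rewrite leq_exp2l // /y leq_pmull.
have [I [misI exI]] := exec_attempt_success adj_sym adj_irr id_inj
  (expn_gt0 2 x) id_le conn cr (seed_bound Vy ky y_gt0).
have [fin short'] := run_exec exI sti.
have stable := done_stable fin.
have all_short t : short_messages adj id x t.
  case: (ltnP t (start_time i)) => [|ge]; first exact: short.
  case: (leqP t (start_time i + success_time (2 ^ i) k)) => [le|lt].
    by apply: short'; rewrite ge.
  by move=> v u m _; rewrite -(subnKC (ltnW lt)) stable.
split=> [t v u m vu /(all_short t v u m vu)|].
  move/leq_trans; apply; rewrite /x /y; nia.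
split; first exact: out_irrevocable.
exists I; split=> // v.
suff le : start_time i + success_time (2 ^ i) k <= 3092 * c.+3 ^ 2 * D.+1 * l ^ 2.
  by rewrite -(subnKC le) stable.
(* A guess of at least [D] is certified, so the guess before the first successful one was below [D],
   and guesses double. *)
have iD : 2 ^ i <= 2 * D.+1.
  case: (i) imin => [|i'] imin; first by rewrite expn0; lia.
  rewrite expnS leq_mul2l /= leqNgt; apply/negP => lt.
  have: cert i'.
    by apply/existsP; apply: certified_exists V_gt0 diam _; lia.
  by move/imin; rewrite ltnn.
rewrite addnC; apply: leq_trans (leq_add (leqnn _) (start_time_le i)) _.
apply: leq_trans (success_time_le _ _) _; rewrite ?expn_gt0 //.
apply: (@leq_trans (1546 * (2 * D.+1 * y ^ 2))).
  by rewrite leq_mul2l leq_mul // leq_exp2r.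
rewrite /y expnMn; lia.
Qed.
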